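(* For every $n\geq 5$ there exist an $n$-dimensional simplex $S\subset\mathbb{R}^n$ with vertices in $\mathbb{Z}^n$ of relative volume $1$ and an infinite sequence $(S_k)_{k\ge 0}$ of pairwise distinct $n$-dimensional simplices with vertices in $\mathbb{Z}^n$ of relative volume $1$ such that, for every $k$, $S\cap S_k$ is a facet of both $S$ and $S_k$, and the $\mathbb{Z}^n$-translates of $S$ and $S_k$ intersect only face-to-face: for every $v\in\mathbb{Z}^n$, the intersection $S\cap(S_k+v)$ is a (possibly empty) common face of $S$ and $S_k+v$.
   Context: The relative volume of an $n$-dimensional simplex in $\mathbb{R}^n$ with vertices in $\mathbb{Z}^n$ is $n!$ times its Euclidean volume (a positive integer). *)

(* Defs.v *)
From mathcomp Require Import all_boot all_order all_algebra.
From mathcomp Require Import all_classical all_reals all_analysis.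

Set Implicit Arguments.
Unset Strict Implicit.
Unset Printing Implicit Defensive.

Import Order.TTheory GRing.Theory Num.Theory.
Import numFieldNormedType.Exports.

Local Open Scope classical_set_scope.
Local Open Scope ring_scope.

(* Lebesgue measure of R^n as the n-fold product of the one-dimensional one:
   the volume of [A] is the integral of the volumes of its slices, which is
   the formula defining the library's product measure.  The function is total,
   and it is the Lebesgue measure on Borel sets (in particular on simplices,
   which are compact). *)
Fixpoint euclidean_volume (R : realType) (n : nat) :
    set 'rV[R]_n -> \bar R :=
  match n with
  | 0 => fun A => (\1_A (0 : 'rV[R]_0))%:E
  | m.+1 => fun A =>
      (\int[lebesgue_measure]_(x in [set: R])
         euclidean_volume [set y : 'rV[R]_m | A (row_mx (x%:M : 'rV[R]_1) y)])%E
  end.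

Definition lattice_point (R : realType) (n : nat) (v : 'rV[R]_n) : Prop :=
  forall j : 'I_n, v 0 j \is a Num.int.

(* The convex hull of the points [P i] with [i] in [I]; empty if [I] is. *)
Definition hull (R : realType) (n m : nat) (P : 'I_m -> 'rV[R]_n)
    (I : {set 'I_m}) : set 'rV[R]_n :=
  [set x | exists w : 'I_m -> R,
     [/\ forall i, i \in I -> 0 <= w i,
         \sum_(i in I) w i = 1
       & x = \sum_(i in I) w i *: P i]].

Definition affinely_independent (R : realType) (n m : nat)
    (P : 'I_m -> 'rV[R]_n) : Prop :=
  forall c : 'I_m -> R,
    \sum_i c i = 0 -> \sum_i c i *: P i = 0 -> forall i, c i = 0.

(* An n-dimensional simplex in R^n is given by its family of n + 1 affinely
   independent vertices; [simplex P] is the corresponding subset of R^n. *)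
Definition simplex (R : realType) (n : nat) (P : 'I_n.+1 -> 'rV[R]_n) :
    set 'rV[R]_n :=
  hull P [set: 'I_n.+1]%SET.

Definition lattice_simplex (R : realType) (n : nat)
    (P : 'I_n.+1 -> 'rV[R]_n) : Prop :=
  affinely_independent P /\ forall i, lattice_point (P i).

Definition relative_volume (R : realType) (n : nat)
    (P : 'I_n.+1 -> 'rV[R]_n) : \bar R :=
  ((n`!)%:R%:E * euclidean_volume (simplex P))%E.

Definition is_face (R : realType) (n : nat) (P : 'I_n.+1 -> 'rV[R]_n)
    (F : set 'rV[R]_n) : Prop :=
  exists I : {set 'I_n.+1}, F = hull P I.

Definition is_facet (R : realType) (n : nat) (P : 'I_n.+1 -> 'rV[R]_n)
    (F : set 'rV[R]_n) : Prop :=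
  exists2 I : {set 'I_n.+1}, #|I| = n & F = hull P I.

Definition translate (R : realType) (n : nat) (P : 'I_n.+1 -> 'rV[R]_n)
    (v : 'rV[R]_n) : 'I_n.+1 -> 'rV[R]_n :=
  fun i => P i + v.

(* Main.v *)
(* Let S be the convex hull of 0 and the unit vectors of R^n, and let S_k be
   obtained from S by replacing e_0 by p_k = (-1, 1, 1, 1, k, 0, ..., 0).  For
   every lattice vector v <> 0, all points of S meeting S_k + v are lattice
   points: at heights 0 < t < 1 the slices are (1 - t) D and a translate of t D,
   where D is the standard simplex, and the three coordinates 1 of p_k already
   prevent these slices from meeting, whatever k is.  As S and S_k have no
   lattice points but their vertices, the intersection is convex with only
   common vertices as points, so it is empty or a single vertex. *)

Require Import Defs.
From mathcomp Require Import all_boot all_order all_algebra.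
From mathcomp Require Import all_classical all_reals all_analysis.
From mathcomp Require Import ring lra.

Set Implicit Arguments.
Unset Strict Implicit.
Unset Printing Implicit Defensive.

Import Order.TTheory GRing.Theory Num.Theory.
Import numFieldNormedType.Exports.

Local Open Scope classical_set_scope.
Local Open Scope ring_scope.

(** * Volumes of scaled standard simplices by slicing *)

Section Volume.
Variable R : realType.

Lemma integral_deriv_poly (p : {poly R}) (l u : R) : l <= u ->
  (\int[lebesgue_measure]_(x in `[l, u]) (p^`().[x])%:E =
   (p.[u] - p.[l])%:E)%E.
Proof.
rewrite le_eqVlt => /predU1P[<-|lu].
  by rewrite set_itv1 integral_set1 subrr.
rewrite (@continuous_FTC2 _ _ (horner p)) //.
- exact/continuous_subspaceT/continuous_horner.
- split=> [x _| |]; first exact: derivable_horner.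
  + by apply: cvg_at_right_filter; exact: continuous_horner.
  + by apply: cvg_at_left_filter; exact: continuous_horner.
- by move=> x _; rewrite derivE.
Qed.

(** The slicing integral of a simplex whose slice at [x] has size [a - e * (x - b)]. The sign [e]
    covers simplices extending above or below the level [b], hence apexes at height 1 and at height
    -1. *)
Lemma integral_truncated_power (a b e : R) (m : nat) : 0 <= a -> e ^+ 2 = 1 ->
  (\int[lebesgue_measure]_(x in [set: R])
     (if (0 <= e * (x - b) <= a)%R
      then (((a - e * (x - b)) ^+ m / m`!%:R)%R)%:E else 0) =
   ((a ^+ m.+1 / m.+1`!%:R)%R)%:E)%E.
Proof.
move=> a0 e2; have {e2} He : e = 1 \/ e = -1.
  by move/eqP: e2; rewrite sqrf_eq1 => /orP[]/eqP; [left|right].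
pose l := if e == 1 then b else b - a.
pose u := if e == 1 then b + a else b.
have N11 : ((-1 : R) == 1) = false by apply/eqP => ?; lra.
have lu : l <= u by rewrite /l /u; case: He => ->; rewrite ?eqxx ?N11; lra.
have inlu (x : R) : (0 <= e * (x - b) <= a) = (x \in `[l, u]).
  rewrite in_itv /= /l /u.
  by case: He => ->; rewrite ?eqxx ?N11; apply/andP/andP => -[? ?]; split; lra.
(* An antiderivative of the integrand: differentiating the power yields a factor [- e], which the
   prefactor [- e] cancels because [e ^+ 2 = 1]. *)
pose p : {poly R} :=
  (- e / m.+1`!%:R) *: (a%:P - e *: ('X - b%:P)) ^+ m.+1.
have fm (k : nat) : (k`!%:R : R) != 0 by rewrite pnatr_eq0 -lt0n fact_gt0.
have m1 : (m.+1%:R : R) != 0 by rewrite pnatr_eq0.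
have dp (x : R) : p^`().[x] = (a - e * (x - b)) ^+ m / m`!%:R.
  rewrite /p derivZ deriv_exp derivB derivC derivZ derivB derivX derivC.
  rewrite !hornerE /= hornerMn !hornerE /= factS natrM.
  by case: He => ->; rewrite ?mulN1r ?mul1r; field;
    rewrite fm addrC natr1 m1.
transitivity (\int[lebesgue_measure]_(x in `[l, u]) (p^`().[x])%:E)%E.
  rewrite [RHS]integral_mkcond; apply: eq_integral => x _.
  by rewrite patchE mem_setE -inlu dp.
rewrite integral_deriv_poly //; congr (_%:E).
rewrite /p /l /u !hornerE /=.
case: He => ->; rewrite ?eqxx ?N11.
- have -> : a - 1 * (b + a - b) = 0 by ring.
  have -> : a - 1 * (b - b) = a by ring.
  by rewrite expr0n /=; field; rewrite fm.
- have -> : a - - 1 * (b - a - b) = 0 by ring.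
  have -> : a - - 1 * (b - b) = a by ring.
  by rewrite expr0n /=; field; rewrite fm.
Qed.

Lemma row_mx_ord0 (m : nat) (x : R) (y : 'rV[R]_m) :
  row_mx (x%:M : 'rV[R]_1) y 0 (ord0 : 'I_m.+1) = x.
Proof.
have -> : (ord0 : 'I_m.+1) = lshift m (ord0 : 'I_1) by apply: val_inj.
by rewrite row_mxEl mxE.
Qed.

Lemma row_mx_lift0 (m : nat) (x : R) (y : 'rV[R]_m) (j : 'I_m) :
  row_mx (x%:M : 'rV[R]_1) y 0 (lift ord0 j : 'I_m.+1) = y 0 j.
Proof.
have -> : (lift ord0 j : 'I_m.+1) = rshift 1 j by apply: val_inj.
by rewrite row_mxEr.
Qed.

(** The standard simplex scaled by [a] and moved to [b]. With an arbitrary base point, the slices of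
    corners, and later those of cones, are again corners or empty. *)
Definition corner (n : nat) (b : 'rV[R]_n) (a : R) : set 'rV[R]_n :=
  [set x | (forall j, b 0 j <= x 0 j) /\ \sum_j (x 0 j - b 0 j) <= a].

Lemma volume_set0 (n : nat) : euclidean_volume (set0 : set 'rV[R]_n) = 0%E.
Proof.
elim: n => [|n IH] /=; first by rewrite indicE in_set0.
by rewrite -[RHS](integral0 lebesgue_measure [set: R]); apply: eq_integral.
Qed.

Lemma corner_empty (n : nat) (b : 'rV[R]_n) (a : R) : a < 0 ->
  corner b a = set0.
Proof.
move=> a0; rewrite -subset0 => x [bx sx]; suff : 0 <= a by lra.
by apply: le_trans sx; apply: sumr_ge0 => j _; rewrite subr_ge0.
Qed.

(** Induction on the dimension: the slice at first coordinate [x] is a corner of size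
    [a - (x - b 0 ord0)], empty once this is negative. *)
Lemma volume_corner (n : nat) (b : 'rV[R]_n) (a : R) : 0 <= a ->
  euclidean_volume (corner b a) = (a ^+ n / n`!%:R)%:E.
Proof.
elim: n b a => [|m IH] b a a0.
  rewrite /= indicE mem_set ?divr1 //; split; first by case.
  by rewrite big_ord0.
rewrite -(@integral_truncated_power a (b 0 ord0) 1 m a0 (expr1n _ _)) /=.
apply: eq_integral => x _; rewrite !mul1r.
pose b' : 'rV[R]_m := \row_j b 0 (lift ord0 j).
have slice : b 0 ord0 <= x ->
    [set y : 'rV_m | corner b a (row_mx (x%:M : 'rV_1) y)] =
    corner b' (a - (x - b 0 ord0)).
  move=> bx; apply/seteqP; split=> y [/= h1 h2]; split.
  - by move=> j; move: (h1 (lift ord0 j)); rewrite row_mx_lift0 mxE.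
  - move: h2; rewrite big_ord_recl row_mx_ord0 -lerBrDl.
    by under eq_bigr do rewrite row_mx_lift0;
      under [X in _ -> X <= _]eq_bigr do rewrite mxE.
  - move=> j; case: (unliftP ord0 j) => [i ->|->]; last by rewrite row_mx_ord0.
    by move: (h1 i); rewrite row_mx_lift0 mxE.
  - rewrite big_ord_recl row_mx_ord0 -lerBrDl; move: h2.
    by under [X in _ -> X <= _]eq_bigr do rewrite row_mx_lift0;
      under eq_bigr do rewrite mxE.
have [bx|bx] := leP (b 0 ord0) x; last first.
  rewrite ifF; last by apply/negbTE/negP => /andP[? _]; lra.
  rewrite (_ : [set _ | _] = set0) ?volume_set0 // -subset0 => y [/= h1 _].
  by move: (h1 ord0); rewrite row_mx_ord0; lra.
rewrite slice //; case: ifPn => [/andP[_ ?]|h].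
  by rewrite IH // subr_ge0.
rewrite corner_empty ?volume_set0 //; rewrite subr_ge0 bx /= -ltNge in h.
lra.
Qed.

End Volume.

(** * Convex hulls *)

Section Hulls.
Variables (R : realType) (n m : nat).
Implicit Types (P : 'I_m -> 'rV[R]_n) (I : {set 'I_m}) (x v : 'rV[R]_n).

(** Weights that vanish outside [I] turn sums over [I] into sums over all indices. *)
Lemma hullP P I x : hull P I x <->
  exists w : 'I_m -> R, [/\ forall i, 0 <= w i, forall i, i \notin I -> w i = 0,
    \sum_i w i = 1 & x = \sum_i w i *: P i].
Proof.
split=> -[w].
  case=> w0 w1 ->; exists (fun i => if i \in I then w i else 0); split.
  - by move=> i; case: ifP => // /w0.
  - by move=> i /negbTE ->.
  - by rewrite -big_mkcond.
  - rewrite big_mkcond; apply: eq_bigr => i _.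
    by case: ifP; rewrite ?scale0r.
case=> w0 wI w1 ->; exists w; split=> //.
- rewrite -w1 big_mkcond; apply: eq_bigr => i _.
  by case: ifPn => // /wI ->.
- rewrite [RHS]big_mkcond; apply: eq_bigr => i _.
  by case: ifPn => // /wI ->; rewrite scale0r.
Qed.

Lemma eq_hull P (Q : 'I_m -> 'rV[R]_n) I :
  (forall i, i \in I -> P i = Q i) -> hull P I = hull Q I.
Proof.
move=> PQ; apply/seteqP; split=> x [w [w0 w1 ->]]; exists w; split=> //;
  by apply: eq_bigr => i iI; rewrite PQ.
Qed.

Lemma hull_set0 P : hull P finset.set0 = set0.
Proof.
rewrite -subset0 => x [w [_]]; rewrite big_set0 => /esym/eqP.
by rewrite oner_eq0.
Qed.

Lemma hull_set1 P i : hull P [set i]%SET = [set P i].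
Proof.
apply/seteqP; split=> x.
  by case=> w [_]; rewrite !big_set1 => -> ->; rewrite scale1r.
by move=> /= ->; exists (fun=> 1); rewrite !big_set1 scale1r.
Qed.

Lemma hull_midpoint P I x y :
  hull P I x -> hull P I y -> hull P I (2^-1 *: (x + y)).
Proof.
move=> [w [w0 w1 ->]] [w' [w'0 w'1 ->]].
exists (fun i => 2^-1 * (w i + w' i)); split.
- by move=> i iI; rewrite mulr_ge0 ?invr_ge0 ?addr_ge0 ?w0 ?w'0.
- by rewrite -mulr_sumr big_split /= w1 w'1; field.
- rewrite -big_split scaler_sumr /=; apply: eq_bigr => i _.
  by rewrite -scalerDl scalerA.
Qed.

End Hulls.

(** * Empty lattice simplices and common faces *)

Section Faces.
Variables (R : realType) (n : nat).
Implicit Types (P Q : 'I_n.+1 -> 'rV[R]_n) (x v : 'rV[R]_n).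

Definition empty_simplex P : Prop :=
  forall x, lattice_point x -> simplex P x -> exists i, x = P i.

Lemma simplex_translate P v x : simplex (translate P v) x <-> simplex P (x - v).
Proof.
have E (w : 'I_n.+1 -> R) : \sum_i w i = 1 ->
    \sum_i w i *: translate P v i = \sum_i w i *: P i + v.
  move=> w1; rewrite -[v in RHS]scale1r -w1 scaler_suml -big_split /=.
  by apply: eq_bigr => i _; rewrite scalerDr.
split=> /hullP[w [w0 wI w1]].
  by rewrite E // => ->; apply/hullP; exists w; rewrite addrK.
by move=> /eqP; rewrite subr_eq -E // => /eqP ->; apply/hullP; exists w.
Qed.

Lemma lattice_pointD x v : lattice_point x -> lattice_point v ->
  lattice_point (x + v).
Proof. by move=> hx hv j; rewrite mxE rpredD. Qed.

Lemma lattice_pointN x : lattice_point x -> lattice_point (- x).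
Proof. by move=> hx j; rewrite mxE rpredN. Qed.

Lemma empty_simplex_translate P v : lattice_point v -> empty_simplex P ->
  empty_simplex (translate P v).
Proof.
move=> hv hP x hx /simplex_translate /hP[]; last first.
  by move=> i hi; exists i; rewrite /translate -hi subrK.
exact/lattice_pointD/lattice_pointN.
Qed.

(* The intersection is convex, while the midpoint of two distinct vertices is
   neither a vertex nor, by emptiness, a lattice point: so the
   intersection has at most one point. *)
Lemma empty_simplex_common_face P Q : affinely_independent P ->
  empty_simplex P -> empty_simplex Q ->
  (forall x, simplex P x -> simplex Q x -> lattice_point x) ->
  is_face P (simplex P `&` simplex Q) /\ is_face Q (simplex P `&` simplex Q).
Proof.
have N (b : bool) : (1 + 0 - 2 * b%:R : R) <> 0 by case: b => /= ?; lra.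
move=> aP fP fQ latt; set A := _ `&` _.
have [[x [Px Qx]]|A0] := pselect (exists x, A x); last first.
  have -> : A = set0 by rewrite -subset0 => x Ax; apply: A0; exists x.
  by split; exists finset.set0; rewrite hull_set0.
have lx := latt _ Px Qx.
have [i xi] := fP _ lx Px; have [j xj] := fQ _ lx Qx.
suff -> : A = [set x].
  by split; [exists [set i]%SET|exists [set j]%SET];
    rewrite hull_set1 -?xi -?xj.
apply/seteqP; split=> y; last by move=> ->.
case=> Py Qy; have [i' yi'] := fP _ (latt _ Py Qy) Py.
have Pz := hull_midpoint Px Py; have Qz := hull_midpoint Qx Qy.
have [l zl] := fP _ (latt _ Pz Qz) Pz.
pose d k : 'I_n.+1 -> R := fun i => (i == k)%:R.
have sd k : \sum_i d k i = 1.
  by rewrite (bigD1 k) //= big1 ?addr0 /d ?eqxx // => ? /negbTE ->.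
have sdP k : \sum_i d k i *: P i = P k.
  rewrite (bigD1 k) //= big1 ?addr0 /d ?eqxx ?scale1r // => ? /negbTE ->.
  by rewrite scale0r.
(* If the midpoint of the vertices [i] and [i'] is the vertex [l], these coefficients form an affine
   dependence, so they vanish. For [i] different from [i'] the one at [i] is 1 or -1, a
   contradiction. *)
have /aP : \sum_k (d i k + d i' k - 2 * d l k) = 0.
  by rewrite sumrB big_split /= -mulr_sumr !sd; ring.
have -> : \sum_k (d i k + d i' k - 2 * d l k) *: P k = 0.
  under eq_bigr do rewrite scalerBl scalerDl -scalerA.
  rewrite sumrB big_split /= -scaler_sumr !sdP -zl -xi -yi' scalerA.
  by rewrite divff ?pnatr_eq0 // scale1r subrr.
move=> /(_ erefl i); rewrite /d eqxx /=.
have [ii'|_] := eqVneq i i'; first by rewrite xi yi' ii'.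
by move=> /N.
Qed.

End Faces.

(** * Nonnegative and integral weights *)

Lemma int_num_lt (R : realType) (a b : R) : a \is a Num.int ->
  b \is a Num.int -> a < b + 1 -> a <= b.
Proof.
move=> /intrP[i ->] /intrP[j ->].
by rewrite -[1]/(1%:~R) -intrD ltr_int ltzD1 ler_int.
Qed.

Section Weights.
Variables (R : realType) (n : nat).
Implicit Types (w : 'I_n -> R).

Lemma ge0_le_sum1 w i : (forall k, 0 <= w k) -> w i <= \sum_k w k.
Proof. by move=> w0; rewrite (bigD1 i) //= lerDl sumr_ge0. Qed.

Lemma ge0_le_sum2 w i j : i != j -> (forall k, 0 <= w k) ->
  w i + w j <= \sum_k w k.
Proof.
move=> ij w0; rewrite (bigD1 i) //= lerD2l (bigD1 j) 1?eq_sym //=.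
by rewrite lerDl sumr_ge0.
Qed.

Lemma weight1_sum w i : (forall k, 0 <= w k) -> \sum_k w k <= 1 -> 1 <= w i ->
  w =1 (fun k => (k == i)%:R).
Proof.
move=> w0 s1 wi k; have [->|ki] := eqVneq k i.
  by have := ge0_le_sum1 i w0 => /= ?; lra.
by have := ge0_le_sum2 ki w0; have := w0 k => /= ? ?; lra.
Qed.

(** An integral weight below 1 is at most 0, so some weight reaches 1 and takes up the whole sum. *)
Lemma int_weights w : (forall k, w k \is a Num.int) -> (forall k, 0 <= w k) ->
  \sum_k w k = 1 -> exists i, w =1 (fun k => (k == i)%:R).
Proof.
move=> wZ w0 s1; have [[i wi]|wn] := pselect (exists i, 1 <= w i).
  by exists i; apply: weight1_sum; rewrite ?s1.
have : \sum_k w k <= 0.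
  apply: sumr_le0 => k _; apply: int_num_lt => //; rewrite add0r ltNge.
  by apply/negP => ?; apply: wn; exists k.
by rewrite s1 ler10.
Qed.

End Weights.

(** * Unimodular simplices over a fixed facet *)

Section Cones.
Variables (R : realType) (m : nat).
Implicit Types (p x v : 'rV[R]_m.+1) (w : 'I_m.+2 -> R).

(** The vertices are 0, then [p] in place of the unit vector e_0, then the other unit vectors. Both
    S and every S_k have this form, with equal vertices at all indices but [apex]. *)
Definition cone p : 'I_m.+2 -> 'rV[R]_m.+1 := fun i =>
  if unlift ord0 i is Some j then (if j == ord0 then p else delta_mx 0 j)
  else 0.

Definition apex : 'I_m.+2 := lift ord0 ord0.

Lemma cone_ord0 p : cone p ord0 = 0.
Proof. by rewrite /cone unlift_none. Qed.

Lemma cone_apex p : cone p apex = p.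
Proof. by rewrite /cone liftK. Qed.

Lemma cone_lift p (j : 'I_m) :
  cone p (lift ord0 (lift ord0 j)) = delta_mx 0 (lift ord0 j).
Proof. by rewrite /cone liftK. Qed.

Lemma sum_cone w :
  \sum_i w i = w ord0 + (w apex + \sum_(j < m) w (lift ord0 (lift ord0 j))).
Proof. by rewrite !big_ord_recl. Qed.

Lemma comb_coneE p w : \sum_i w i *: cone p i =
  w apex *: p +
  \sum_(j < m) w (lift ord0 (lift ord0 j)) *: delta_mx 0 (lift ord0 j).
Proof.
rewrite !big_ord_recl cone_ord0 cone_apex scaler0 add0r; congr (_ + _).
by apply: eq_bigr => j _; rewrite cone_lift.
Qed.

Lemma comb_cone0 p w : (\sum_i w i *: cone p i) 0 ord0 = w apex * p 0 ord0.
Proof.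
rewrite comb_coneE !mxE summxE big1 ?addr0 // => j _.
by rewrite !mxE /= mulr0.
Qed.

Lemma comb_coneS p w j : (\sum_i w i *: cone p i) 0 (lift ord0 j) =
  w apex * p 0 (lift ord0 j) + w (lift ord0 (lift ord0 j)).
Proof.
rewrite comb_coneE !mxE summxE (bigD1 j) //= big1 ?addr0.
  by rewrite !mxE !eqxx mulr1.
by move=> i ij; rewrite !mxE eqxx (inj_eq lift_inj) eq_sym (negbTE ij) mulr0.
Qed.

Lemma cone_ind (Q : 'I_m.+2 -> Prop) :
  Q ord0 -> Q apex -> (forall j, Q (lift ord0 (lift ord0 j))) -> forall i, Q i.
Proof.
move=> q0 q1 q2 i; case: (unliftP ord0 i) => [j ->|->] //.
by case: (unliftP ord0 j) => [k ->|->].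
Qed.

Variable p : 'rV[R]_m.+1.
Hypothesis p0 : p 0 ord0 ^+ 2 = 1.
Local Notation e := (p 0 ord0).

Lemma affinely_independent_cone : affinely_independent (cone p).
Proof.
move=> c sc combc.
have c1 : c apex = 0.
  have /eqP := congr1 (fun x : 'rV_m.+1 => x 0 ord0) combc.
  rewrite /= comb_cone0 mxE mulf_eq0 => /orP[/eqP //|/eqP e0].
  by move: p0; rewrite e0 expr0n => /esym/eqP; rewrite oner_eq0.
have c2 j : c (lift ord0 (lift ord0 j)) = 0.
  have := congr1 (fun x : 'rV_m.+1 => x 0 (lift ord0 j)) combc.
  by rewrite /= comb_coneS mxE c1 mul0r add0r.
elim/cone_ind => //.
by move: sc; rewrite sum_cone c1 big1 ?addr0.
Qed.

Lemma lattice_point_cone :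
  lattice_point p -> forall i, lattice_point (cone p i).
Proof.
move=> lp; elim/cone_ind.
- by rewrite cone_ord0 => j; rewrite mxE int_num0.
- by rewrite cone_apex.
- by move=> j k; rewrite cone_lift mxE /= natr_int.
Qed.

(** Since [e] is its own inverse, no division occurs: for a lattice point [p] the weights are
    integral linear forms in the coordinates of [x]. This is the unimodularity of the cone. *)
Lemma cone_weights x w : x = \sum_i w i *: cone p i ->
  w apex = e * x 0 ord0 /\
  forall j, w (lift ord0 (lift ord0 j)) =
    x 0 (lift ord0 j) - e * x 0 ord0 * p 0 (lift ord0 j).
Proof.
move=> xE.
have -> : e * x 0 ord0 = w apex.
  by rewrite xE comb_cone0 mulrCA -expr2 p0 mulr1.
by split=> // j; rewrite xE comb_coneS; ring.
Qed.

(** The three conditions say that the weights of [p], of the unit vectors and of the origin are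
    nonnegative. *)
Lemma simplex_coneP x : simplex (cone p) x <->
  [/\ 0 <= e * x 0 ord0,
      forall j, e * x 0 ord0 * p 0 (lift ord0 j) <= x 0 (lift ord0 j)
    & e * x 0 ord0 + \sum_(j < m) (x 0 (lift ord0 j)
        - e * x 0 ord0 * p 0 (lift ord0 j)) <= 1].
Proof.
split.
  move=> /hullP[w [w0 _ s1 xE]]; have [w1 w2] := cone_weights xE.
  split; first by rewrite -w1.
  - by move=> j; rewrite -subr_ge0 -w2.
  - under eq_bigr do rewrite -w2; rewrite -w1.
    by move: s1; rewrite sum_cone; have := w0 ord0; lra.
move=> [h0 h1 h2]; apply/hullP.
set s := e * x 0 ord0 in h0 h1 h2 *.
pose y j := x 0 (lift ord0 j) - s * p 0 (lift ord0 j).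
pose w (i : 'I_m.+2) := if unlift ord0 i is Some j then
  (if unlift ord0 j is Some k then y k else s) else 1 - (s + \sum_j y j).
have w0E : w ord0 = 1 - (s + \sum_j y j) by rewrite /w unlift_none.
have w1E : w apex = s by rewrite /w liftK unlift_none.
have w2E j : w (lift ord0 (lift ord0 j)) = y j by rewrite /w !liftK.
exists w; split.
- elim/cone_ind.
  + by rewrite w0E subr_ge0.
  + by rewrite w1E.
  + by move=> j; rewrite w2E subr_ge0.
- by move=> i; rewrite finset.inE.
- by rewrite sum_cone w0E w1E (eq_bigr _ (fun j _ => w2E j)); ring.
- apply/rowP => i; case: (unliftP ord0 i) => [j ->|->].
    by rewrite comb_coneS w1E w2E /y; ring.
  by rewrite comb_cone0 w1E /s mulrAC -expr2 p0 mul1r.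
Qed.

(** The slice at height [x] is a corner of size [1 - e * x]. The other coordinates of [p] only move
    its base point, so they do not affect the volume. *)
Lemma volume_cone :
  euclidean_volume (simplex (cone p)) = ((m.+1`!%:R)^-1)%:E.
Proof.
have -> : (m.+1`!%:R)^-1 = 1 ^+ m.+1 / m.+1`!%:R :> R by rewrite expr1n mul1r.
rewrite -(@integral_truncated_power R 1 0 e m ler01 p0) /=.
apply: eq_integral => x _; rewrite subr0.
pose p' : 'rV[R]_m := \row_j p 0 (lift ord0 j).
have [s0|s0] := leP 0 (e * x); last first.
  rewrite /= (_ : [set _ | _] = set0) ?volume_set0 // -subset0 => y /=.
  by move/simplex_coneP => []; rewrite row_mx_ord0 leNgt s0.
have -> : [set y : 'rV_m | simplex (cone p) (row_mx (x%:M : 'rV_1) y)] =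
    corner ((e * x) *: p') (1 - e * x).
  apply/seteqP; split=> y /=.
    move/simplex_coneP; rewrite row_mx_ord0 => -[_ h1 h2]; split.
      by move=> j; move: (h1 j); rewrite row_mx_lift0 !mxE.
    rewrite -lerBrDl in h2; apply: le_trans h2; apply: ler_sum => j _.
    by rewrite row_mx_lift0 !mxE.
  move=> [h1 h2]; apply/simplex_coneP; rewrite row_mx_ord0; split=> //.
    by move=> j; move: (h1 j); rewrite row_mx_lift0 !mxE.
  rewrite -lerBrDl; apply: le_trans h2; apply: ler_sum => j _.
  by rewrite row_mx_lift0 !mxE.
case: ifPn => [s1|]; first by rewrite volume_corner // subr_ge0.
by rewrite -ltNge => s1; rewrite corner_empty ?volume_set0 // subr_lt0.
Qed.

Lemma relative_volume_cone : relative_volume (cone p) = 1%E.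
Proof.
by rewrite /relative_volume volume_cone -EFinM divff // pnatr_eq0 -lt0n
  fact_gt0.
Qed.

(** The weights of a lattice point are integers, nonnegative and of sum 1, so one of them is 1 and
    the point is a vertex. *)
Lemma empty_simplex_cone : lattice_point p -> empty_simplex (cone p).
Proof.
move=> lp x lx /hullP[w [w0 _ s1 xE]]; have [w1 w2] := cone_weights xE.
have [|i wi] := int_weights _ w0 s1.
  have Z1 : w apex \is a Num.int by rewrite w1 rpredM.
  have Z2 j : w (lift ord0 (lift ord0 j)) \is a Num.int.
    by rewrite w2 rpredB ?rpredM.
  elim/cone_ind => //.
  have -> : w ord0 = 1 - (w apex + \sum_j w (lift ord0 (lift ord0 j))).
    by rewrite -s1 sum_cone addrK.
  by rewrite rpredB ?int_num1 // rpredD ?rpred_sum.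
exists i; rewrite xE (bigD1 i) //= big1 ?addr0 ?wi ?eqxx ?scale1r // => k.
by rewrite wi => /negbTE ->; rewrite scale0r.
Qed.

Lemma simplex_cone_base x : simplex (cone p) x -> x 0 ord0 = 0 ->
  hull (cone p) [set~ apex]%SET x.
Proof.
move=> /hullP[w [w0 _ s1 xE]] x0; have [w1 _] := cone_weights xE.
apply/hullP; exists w; split=> // i.
by rewrite !finset.inE negbK => /eqP ->; rewrite w1 x0 mulr0.
Qed.

End Cones.

Lemma hull_cone_base (R : realType) (m : nat) (p q : 'rV[R]_m.+1) :
  hull (cone p) [set~ apex m]%SET = hull (cone q) [set~ apex m]%SET.
Proof.
apply: eq_hull; elim/cone_ind => [_|/[!finset.inE]/negP|j _].
- by rewrite !cone_ord0.
- by rewrite eqxx.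
- by rewrite !cone_lift.
Qed.

Lemma hull_subset_simplex (R : realType) (n : nat) (P : 'I_n.+1 -> 'rV[R]_n) I :
  hull P I `<=` simplex P.
Proof.
move=> x /hullP[w [w0 _ s1 xE]]; apply/hullP; exists w; split=> // i.
by rewrite finset.inE.
Qed.

(** * Two cones on opposite sides of the hyperplane x_0 = 0 *)

Section OppositeCones.
Variables (R : realType) (m : nat).
Implicit Types (p x v : 'rV[R]_m.+1).

(** The standard simplex, written as the cone with apex e_0 so that the results on cones apply to it
    with [e] equal to 1. *)
Definition unit_cone : 'I_m.+2 -> 'rV[R]_m.+1 := cone (delta_mx 0 ord0).

Lemma unit_coneP x : simplex unit_cone x <->
  [/\ 0 <= x 0 ord0, forall j : 'I_m, 0 <= x 0 (lift ord0 j)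
    & x 0 ord0 + \sum_(j < m) x 0 (lift ord0 j) <= 1].
Proof.
have d0 : (delta_mx 0 ord0 : 'rV[R]_m.+1) 0 ord0 = 1 by rewrite !mxE !eqxx.
have dS j : (delta_mx 0 ord0 : 'rV[R]_m.+1) 0 (lift ord0 j) = 0 by rewrite !mxE.
have E j : x 0 (lift ord0 j) - 1 * x 0 ord0 *
    (delta_mx 0 ord0 : 'rV[R]_m.+1) 0 (lift ord0 j) = x 0 (lift ord0 j).
  by rewrite dS mulr0 subr0.
rewrite simplex_coneP d0 ?expr1n // (eq_bigr _ (fun j _ => E j)) mul1r.
by split=> -[h0 h1 h2]; split=> // j; have := h1 j; rewrite dS mulr0.
Qed.

Lemma opposite_coneP p x : p 0 ord0 = -1 -> simplex (cone p) x <->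
  [/\ 0 <= - x 0 ord0,
      forall j : 'I_m, - x 0 ord0 * p 0 (lift ord0 j) <= x 0 (lift ord0 j)
    & - x 0 ord0 + \sum_(j < m) (x 0 (lift ord0 j)
        - - x 0 ord0 * p 0 (lift ord0 j)) <= 1].
Proof. by move=> pN; rewrite simplex_coneP pN ?sqrrN ?expr1n // mulN1r. Qed.

(* With t the height of x, all points of the intersection at an integral height
   t are lattice points.  If 0 < t < 1, then x = y + t e_0 and
   x - v = z + (1 - t) p where y, z >= 0 have coordinate sums at most 1 - t and
   t.  Where p has coordinate 1, y_j - z_j is congruent to - t, so y_j >= 1 - t
   or z_j >= t; each happens for at most one j, so not for three of them. *)
Lemma opposite_cones_lattice p v x (j1 j2 j3 : 'I_m) :
  p 0 ord0 = -1 -> lattice_point p -> uniq [:: j1; j2; j3] ->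
  (forall j, j \in [:: j1; j2; j3] -> p 0 (lift ord0 j) = 1) ->
  lattice_point v -> v != 0 ->
  simplex unit_cone x -> simplex (cone p) (x - v) -> lattice_point x.
Proof.
move=> pN lp uj pj lv v0 /unit_coneP[]; set t := x 0 ord0.
pose y j := x 0 (lift ord0 j).
move=> t0 y0; rewrite -/y => sy.
move/(opposite_coneP _ pN); rewrite !mxE -/t.
have -> : - (t - v 0 ord0) = v 0 ord0 - t by rewrite opprB.
set s := v 0 ord0 - t.
pose z j := y j - v 0 (lift ord0 j) - s * p 0 (lift ord0 j).
have zE j : (x - v) 0 (lift ord0 j) - s * p 0 (lift ord0 j) = z j.
  by rewrite /z /y !mxE.
move=> [s0 z0]; rewrite (eq_bigr _ (fun j _ => zE j)) => sz.
have {}z0 j : 0 <= z j by rewrite -zE subr_ge0.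
have sy0 : 0 <= \sum_j y j by apply: sumr_ge0 => j _; exact: y0.
have sz0 : 0 <= \sum_j z j by apply: sumr_ge0 => j _; exact: z0.
have lattx : t \is a Num.int -> (forall j, y j \is a Num.int) ->
    lattice_point x.
  by move=> tZ yZ i; case: (unliftP ord0 i) => [j ->|->]; [exact: yZ|].
have yz j : y j = z j + v 0 (lift ord0 j) + s * p 0 (lift ord0 j).
  by rewrite /z; ring.
have tE : t = v 0 ord0 - s by rewrite /s; ring.
have flat (u : 'I_m -> R) : (forall j, 0 <= u j) -> \sum_j u j <= 0 ->
    forall j, u j = 0.
  by move=> u0 su j; apply/eqP; rewrite eq_le u0 (le_trans _ su) ?ge0_le_sum1.
(* Extreme heights: [s = 1] forces [z = 0], so that x - v is the apex [p], and [t = 1] forces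
   [y = 0], so that x is e_0. *)
have [s1|s1] := eqVneq s 1.
  apply: lattx => [|j]; first by rewrite tE s1 rpredB ?int_num1.
  by rewrite yz flat ?add0r; [rewrite s1 rpredD ?rpredM ?int_num1 | | lra].
have [t1|t1] := eqVneq t 1.
  apply: lattx => [|j]; first by rewrite t1 int_num1.
  by rewrite flat ?int_num0 //; lra.
have {s1}s1 : s < 1 by rewrite lt_neqAle s1; lra.
have {t1}t1 : t < 1 by rewrite lt_neqAle t1; lra.
(* Here [t + s = 0], so both heights are 0 and two translates of the standard simplex of the base
   are compared. A nonzero integral coordinate of [v] forces [y j >= 1] or [z j >= 1], which fixes
   all of [y] or all of [z]. *)
have [v00|v00] := eqVneq (v 0 ord0) 0.
  have t00 : t = 0 by move: tE; rewrite v00; lra.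
  have s00 : s = 0 by move: tE; rewrite v00; lra.
  have yz' j : y j = z j + v 0 (lift ord0 j) by rewrite yz s00 mul0r addr0.
  have [j vj] : exists j, v 0 (lift ord0 j) != 0.
    apply/existsP; rewrite -negb_forall; apply: contra v0 => /forallP v0.
    apply/eqP/rowP => i; rewrite mxE.
    by case: (unliftP ord0 i) => [j ->|->] //; exact/eqP.
  have [vp|vn] := leP 1 (v 0 (lift ord0 j)).
    have yj : 1 <= y j by rewrite yz'; have := z0 j; lra.
    apply: lattx => [|k]; first by rewrite t00 int_num0.
    by rewrite (@weight1_sum _ _ y j) ?natr_int //; lra.
  have vn' : v 0 (lift ord0 j) + 1 <= 0.
    apply: int_num_lt; rewrite ?rpredD ?int_num0 ?int_num1 //.
    rewrite ltrD2r lt_neqAle vj; apply: int_num_lt; rewrite ?int_num0 //.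
    by rewrite add0r.
  have zj : 1 <= z j by have := yz' j; have := y0 j; rewrite -/(y j); lra.
  apply: lattx => [|k]; first by rewrite t00 int_num0.
  by rewrite yz' (@weight1_sum _ _ z j) ?rpredD ?natr_int //; lra.
(* The nonzero integer [v 0 ord0] equals [t + s], where both terms lie in [0, 1). Hence [s = 1 - t]
   and 0 < t < 1. *)
have v01 : v 0 ord0 = 1.
  have v0le : v 0 ord0 <= 1.
    by apply: int_num_lt; rewrite ?int_num1 //; rewrite tE in t1; lra.
  have v0ge : 0 < v 0 ord0 by rewrite lt_neqAle eq_sym v00; move: tE; lra.
  apply/eqP; rewrite eq_le v0le; apply: int_num_lt; rewrite ?int_num1 //; lra.
exfalso.
have dich j : j \in [:: j1; j2; j3] -> 1 - t <= y j \/ t <= z j.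
  move=> /pj pj1; have := yz j; rewrite pj1 mulr1 /s v01 => E.
  have [vp|vn] := leP 0 (v 0 (lift ord0 j)).
    by left; rewrite E; have := z0 j; lra.
  right; have vn' : v 0 (lift ord0 j) + 1 <= 0.
    by apply: int_num_lt; rewrite ?rpredD ?int_num0 ?int_num1 //; lra.
  by have := y0 j; rewrite -/(y j); lra.
move: tE; rewrite v01 => tE.
have noy i j : i != j -> 1 - t <= y i -> 1 - t <= y j -> False.
  by move=> ij; have := ge0_le_sum2 ij y0; rewrite -/(y i) -/(y j); lra.
have noz i j : i != j -> t <= z i -> t <= z j -> False.
  by move=> ij; have := ge0_le_sum2 ij z0; lra.
move: uj; rewrite /= !inE negb_or andbT => /andP[/andP[j12 j13] j23].
have d1 := dich j1 (mem_head _ _).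
have d2 : 1 - t <= y j2 \/ t <= z j2 by apply: dich; rewrite !inE eqxx orbT.
have d3 : 1 - t <= y j3 \/ t <= z j3 by apply: dich; rewrite !inE eqxx !orbT.
case: d1 d2 d3 => d1 [] d2 [] d3.
- exact: noy j12 d1 d2.
- exact: noy j12 d1 d2.
- exact: noy j13 d1 d3.
- exact: noz j23 d2 d3.
- exact: noy j23 d2 d3.
- exact: noz j13 d1 d3.
- exact: noz j12 d1 d2.
- exact: noz j12 d1 d2.
Qed.

(** One simplex lies in x_0 >= 0 and the other in x_0 <= 0, so common points have height 0 and lie
    in the shared facet opposite the apexes. *)
Lemma opposite_cones_base p : p 0 ord0 = -1 ->
  simplex unit_cone `&` simplex (cone p) = hull unit_cone [set~ apex m]%SET.
Proof.
move=> pN; apply/seteqP; split=> x; last first.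
  move=> hx; split; first exact: hull_subset_simplex hx.
  apply: (@hull_subset_simplex _ _ _ [set~ apex m]%SET).
  by rewrite (hull_cone_base _ (delta_mx 0 ord0)).
move=> [Sx /(opposite_coneP _ pN)[xle _ _]].
apply: simplex_cone_base => //; first by rewrite !mxE !eqxx expr1n.
have /unit_coneP[xge _ _] := Sx; lra.
Qed.

End OppositeCones.

(** * The infinite family of apexes and the theorem *)

Section Family.
Variables (R : realType) (m : nat).

(** The point p_k. In dimension [m.+4.+1] there is room for the height, three coordinates 1 and one
    coordinate that carries [k]. *)
Definition far_apex (k : nat) : 'rV[R]_m.+4.+1 :=
  \row_j (if j == 0%N :> nat then -1 else if (j <= 3)%N then 1
          else if j == 4%N :> nat then k%:R else 0).

Lemma far_apex0 k : far_apex k 0 ord0 = -1.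
Proof. by rewrite mxE. Qed.

Lemma far_apex4 k : far_apex k 0 (inord 4) = k%:R.
Proof. by rewrite mxE inordK. Qed.

Lemma lattice_far_apex k : lattice_point (far_apex k).
Proof.
move=> j; rewrite mxE; case: ifP => _; first by rewrite rpredN int_num1.
case: ifP => _; first exact: int_num1.
by case: ifP => _; [exact: natr_int|exact: int_num0].
Qed.

(** At height -1 the second simplex contains only its apex, and it contains the apex of the first.
    So the two apexes agree, in particular in the coordinate that carries the parameter. *)
Lemma simplex_far_apex_inj j k :
  simplex (cone (far_apex j)) = simplex (cone (far_apex k)) -> j = k.
Proof.
move=> E; have : simplex (cone (far_apex j)) (far_apex j).
  apply/(opposite_coneP _ (far_apex0 j)); rewrite far_apex0 opprK; split=> //.
    by move=> i; rewrite mul1r.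
  by rewrite big1 ?addr0 // => i _; rewrite mul1r subrr.
rewrite E => /(opposite_coneP _ (far_apex0 k)); rewrite far_apex0 opprK.
move=> [_ h1 h2].
pose u i := far_apex j 0 (lift ord0 i) - 1 * far_apex k 0 (lift ord0 i).
have u0 i : 0 <= u i by rewrite subr_ge0 h1.
(* Indices of [u] skip the height, so 3 stands for coordinate 4. *)
have : u (inord 3) = 0.
  apply/eqP; rewrite eq_le u0 andbT (le_trans (ge0_le_sum1 _ u0)) //.
  by move: h2; rewrite -/u; lra.
rewrite /u.
have -> : lift ord0 (inord 3 : 'I_m.+4) = inord 4.
  by apply: val_inj; rewrite /= !inordK.
by rewrite !far_apex4 mul1r => /subr0_eq /eqP; rewrite eqr_nat => /eqP.
Qed.

End Family.

Theorem theorem6p1 (R : realType) (n : nat) (hn : (5 <= n)%N) :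
  exists (S : 'I_n.+1 -> 'rV[R]_n) (T : nat -> 'I_n.+1 -> 'rV[R]_n),
    [/\ lattice_simplex S /\ relative_volume S = 1%E,
        forall k, lattice_simplex (T k) /\ relative_volume (T k) = 1%E,
        forall j k, j <> k -> simplex (T j) <> simplex (T k),
        forall k, is_facet S (simplex S `&` simplex (T k)) /\
                  is_facet (T k) (simplex S `&` simplex (T k))
      & forall (k : nat) (v : 'rV[R]_n), lattice_point v ->
          is_face S (simplex S `&` simplex (translate (T k) v)) /\
          is_face (translate (T k) v)
                  (simplex S `&` simplex (translate (T k) v))].
Proof.
case: n hn => [|[|[|[|[|m]]]]] // _.
pose T k := cone (far_apex R m k).
have d0 : (delta_mx 0 ord0 : 'rV[R]_m.+4.+1) 0 ord0 ^+ 2 = 1.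
  by rewrite !mxE !eqxx expr1n.
have p0 k : far_apex R m k 0 ord0 ^+ 2 = 1 by rewrite far_apex0 sqrrN expr1n.
have ld : lattice_point (delta_mx 0 ord0 : 'rV[R]_m.+4.+1).
  by move=> j; rewrite mxE natr_int.
have base k : simplex (@unit_cone R m.+4) `&` simplex (T k) =
    hull (T k) [set~ apex m.+4]%SET.
  by rewrite opposite_cones_base ?far_apex0 //; exact: hull_cone_base.
exists (@unit_cone R m.+4), T; split.
- split; last exact: relative_volume_cone.
  by split; [exact: affinely_independent_cone|exact: lattice_point_cone].
- move=> k; split; last exact: relative_volume_cone.
  split; first exact: affinely_independent_cone.
  exact/lattice_point_cone/lattice_far_apex.
- by move=> j k jk /simplex_far_apex_inj.
- move=> k; rewrite base; split; exists [set~ apex m.+4]%SET => //.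
  + by rewrite cardsC1 card_ord.
  + exact: hull_cone_base.
  + by rewrite cardsC1 card_ord.
(* For [v = 0] the intersection is a whole facet; for other [v] it has at most one point. *)
- move=> k v lv; have [->|v0] := eqVneq v 0.
    have -> : translate (T k) 0 = T k.
      by apply/funext => i; rewrite /translate addr0.
    rewrite base; split; exists [set~ apex m.+4]%SET => //.
    exact: hull_cone_base.
  apply: empty_simplex_common_face.
  + exact: affinely_independent_cone.
  + exact: empty_simplex_cone.
  + apply/empty_simplex_translate/empty_simplex_cone => //.
    exact: lattice_far_apex.
  + move=> x Sx /simplex_translate Tx.
    (* With the height skipped, the indices 0, 1, 2 are the coordinates 1, 2, 3, where p_k has the
       entry 1. *)
    apply: (@opposite_cones_lattice _ _ (far_apex R m k) v x
      (inord 0) (inord 1) (inord 2)) => //.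
    * exact: far_apex0.
    * exact: lattice_far_apex.
    * by rewrite /= !inE -!val_eqE /= !inordK.
    * by move=> j; rewrite !inE => /or3P[]/eqP ->; rewrite mxE /= inordK.
Qed.
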